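(* Let $\varepsilon>0$ and $\lambda_0:=\frac{(1-\delta_2)\varepsilon}{\log2}>0$. For every $\lambda\in(0,\lambda_0)$ and every randomized regular equilibrium $p\in\mathcal{R}_0$ of the entropy-regularized Stackelberg stopping game with parameter $\lambda$, the triple $(p,(r,q))$ with $(r,q)=(r^{*,\lambda},q^{*,\lambda}(p))$ is an $\varepsilon$-equilibrium of the original (unregularized) game, i.e. for all $x\in\mathbb{X}$, $$J_2(x,p,(r,q))\ge J_2(x,p,(r',q'))-\varepsilon\quad\forall (r',q')\in\mathcal{R}_0^2,$$ $$J_1(x,p,(r,q))\ge J_1(x,p'\oplus_1p,(r,q))-\varepsilon\quad\forall p'\in\mathcal{R}_0.$$
   Context: $\mathbb{X}$ is a Polish space, $X=(X_t)_{t\ge0}$ a time-homogeneous Markov chain on $\mathbb{X}$ with kernel $\Pi(x,dy)=\pi(x,y)\mu(dy)$ for a fixed reference probability measure $\mu$; $\mathbb{E}_x$ is expectation given $X_0=x$. $f_i,g_i,h_i:\mathbb{X}\to\mathbb{R}$ ($i=1,2$) are bounded Borel functions and $\delta_1,\delta_2\in(0,1)$. $\mathcal{R}_0$ is the set of Borel functions $p:\mathbb{X}\to[0,1]$. $Y,Y'$ are independent i.i.d. uniform $[0,1]$ sequences independent of $X$. The leader using $p\in\mathcal{R}_0$ stops at $\tau^p=\inf\{t\ge0:Y_t\le p_{X_t}\}$; the follower using $(r,q)\in\mathcal{R}_0^2$ stops at $\tau^{r,q}=\inf\{t\ge0:Y'_t\le r_{X_t}1_{\{\tau^p\le t\}}+q_{X_t}1_{\{\tau^p>t\}}\}$.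 With $F_1(\tau,\rho)=f_1(X_\tau)1_{\{\tau<\rho\}}+g_1(X_\rho)1_{\{\rho<\tau\}}+h_1(X_\tau)1_{\{\rho=\tau\}}$ and $F_2(\tau,\rho)=f_2(X_\rho)1_{\{\rho<\tau\}}+g_2(X_\tau)1_{\{\tau<\rho\}}+h_2(X_\rho)1_{\{\rho=\tau\}}$, let $J_i(x,p,(r,q))=\mathbb{E}_x[\delta_i^{\tau^p\wedge\tau^{r,q}}F_i(\tau^p,\tau^{r,q})]$ (zero payoff if nobody stops), and, with $\mathcal{H}(q)=-q\log q-(1-q)\log(1-q)$, $$J_2^\lambda(x,p,(r,q))=J_2(x,p,(r,q))+\lambda\,\mathbb{E}_x\Big[\sum_{t=0}^{\tau^p\wedge\tau^{r,q}}\delta_2^t\,\mathcal{H}\big(q_{X_t}1_{\{\tau^p>t\}}+r_{X_t}1_{\{\tau^p=t\}}\big)\Big].$$ For $p'\in\mathcal{R}_0$, $p'\oplus_1p$ means the leader uses $p'$ at the first step and $p$ afterwards, and $J_1(x,p'\oplus_1p,(r,q))=p'_x[r_xh_1(x)+(1-r_x)f_1(x)]+(1-p'_x)[q_xg_1(x)+(1-q_x)\delta_1\mathbb{E}_x[J_1(X_1,p,(r,q))]]$. The follower's optimal response to $p$ in the regularized game (the maximizer of $J^\lambda_2(x,p,\cdot)$ over $\mathcal{R}_0^2$ for all $x$) is $$r^{*,\lambda}_x=\frac1{1+\exp((g_2(x)-h_2(x))/\lambda)},\qquad q^{*,\lambda}_x(p)=\frac{1}{1+\exp\big((\delta_2\mathbb{E}_x[p_{X_1}W^\lambda_S(X_1)+(1-p_{X_1})W^\lambda_C(X_1,p)]-f_2(x))/\lambda\big)},$$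 where $W_S^\lambda(x)=\sup_{r\in[0,1]}\{rh_2(x)+(1-r)g_2(x)+\lambda\mathcal{H}(r)\}$ and $W_C^\lambda(x,p)=\sup_{(r,q)\in\mathcal{R}_0^2}\{q_xf_2(x)+(1-q_x)\delta_2\mathbb{E}_x[J_2^\lambda(X_1,p,(r,q))]+\lambda\mathcal{H}(q_x)\}$. $p\in\mathcal{R}_0$ is a randomized regular equilibrium with parameter $\lambda$ if, with $(r,q)=(r^{*,\lambda},q^{*,\lambda}(p))$, for every $x\in\mathbb{X}$: $J_2^\lambda(x,p,(r,q))=\sup_{(r',q')\in\mathcal{R}_0^2}J_2^\lambda(x,p,(r',q'))$ and $J_1(x,p,(r,q))=\sup_{p'\in\mathcal{R}_0}J_1(x,p'\oplus_1p,(r,q))$. *)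

(* Defs.v *)
From HB Require Import structures.
From mathcomp Require Import all_boot all_order all_algebra finmap.
From mathcomp Require Import all_classical all_reals all_analysis.

Set Implicit Arguments.
Unset Strict Implicit.
Unset Printing Implicit Defensive.

Import Order.TTheory GRing.Theory Num.Theory.
Import numFieldNormedType.Exports.

Local Open Scope classical_set_scope.
Local Open Scope ring_scope.

(* Pointedness of [T] is no restriction: a space carrying a probability measure
   is nonempty. *)
Notation Borel T := (g_sigma_algebraType (@open T)).

Definition polish_space (R : realType) (T : topologicalType) : Prop :=
  (exists2 D : set T, countable D & dense D) /\
  exists dist : T -> T -> R,
    [/\ forall x y, dist x y = 0 <-> x = y,
        forall x y, dist x y = dist y x,
        forall x y z, dist x z <= dist x y + dist y z,
        forall A : set T, open A <->
          forall x, A x -> exists2 e : R, 0 < e & [set y | dist x y < e] `<=` A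
      & forall u : nat -> T,
          (forall e : R, 0 < e -> exists N, forall m n,
             (N <= m)%N -> (N <= n)%N -> dist (u m) (u n) < e) ->
          exists l : T, u n @[n --> \oo] --> l].

Definition mutually_independent (R : realType) (d : measure_display)
    (Omega : measurableType d) (Pr : {measure set Omega -> \bar R})
    (I : choiceType) (F : I -> set_system Omega) : Prop :=
  forall (J : {fset I}) (A : I -> set Omega),
    (forall i, i \in J -> F i (A i)) ->
    Pr (\bigcap_(i in [set` J]) A i) = (\prod_(i <- J) Pr (A i))%E.

Definition sigma_gen (d d' : measure_display) (Omega : measurableType d)
    (T : measurableType d') (Z : nat -> Omega -> T) (D : set nat) :
    set_system Omega :=
  <<s \bigcup_(t in D) preimage_set_system [set: Omega] (Z t) measurable >>.

(* [law M x] is the probability P_x under which the chain starts from x. *)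
Record model (R : realType) (S : ptopologicalType) (d : measure_display)
    (Omega : measurableType d) := Model {
  law : R.-pker (Borel S) ~> Omega ;
  state : nat -> {mfun Omega >-> Borel S} ;
  leader_unif : nat -> {mfun Omega >-> R} ;
  follower_unif : nat -> {mfun Omega >-> R} }.

Record payoffs (R : realType) (S : ptopologicalType) := Payoffs {
  pay_f : Borel S -> R ;
  pay_g : Borel S -> R ;
  pay_h : Borel S -> R ;
  discount : R }.

Section Assumptions.
Context {R : realType} {S : ptopologicalType}.

Definition bounded_borel (f : Borel S -> R) : Prop :=
  measurable_fun [set: Borel S] f /\ bounded_fun f.

Definition payoffs_ok (A : payoffs R S) : Prop :=
  [/\ bounded_borel (pay_f A), bounded_borel (pay_g A), bounded_borel (pay_h A)
    & 0 < discount A < 1].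

Definition transition_density (mu : probability (Borel S) R)
    (pi : Borel S -> Borel S -> R) : Prop :=
  [/\ measurable_fun [set: Borel S * Borel S] (fun z => pi z.1 z.2),
      forall x y, 0 <= pi x y
    & forall x, (\int[mu]_y (pi x y)%:E = 1)%E].

Definition transition (mu : probability (Borel S) R)
    (pi : Borel S -> Borel S -> R) (x : Borel S) (B : set (Borel S)) : \bar R :=
  (\int[mu]_(y in B) (pi x y)%:E)%E.

Context {d : measure_display} {Omega : measurableType d}.
Context (M : model R S Omega).

(* The second clause says that P_x[X_(n+1) \in B | X_0, ..., X_n] = Pi(X_n, B)
   almost surely. *)
Definition markov_chain (mu : probability (Borel S) R)
    (pi : Borel S -> Borel S -> R) : Prop :=
  forall x : Borel S,
    law M x (state M 0%N @^-1` [set x]) = 1%E /\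
    forall (n : nat) (A : set Omega) (B : set (Borel S)),
      sigma_gen (fun t => state M t : Omega -> Borel S)
        [set t | (t <= n)%N] A ->
      measurable B ->
      law M x (A `&` state M n.+1 @^-1` B) =
      (\int[law M x]_(w in A) transition mu pi (state M n w) B)%E.

Definition independent_uniforms : Prop :=
  forall x : Borel S,
    [/\ forall t (B : set R), measurable B ->
          law M x (leader_unif M t @^-1` B) = uniform_prob (@ltr01 R) B,
        forall t (B : set R), measurable B ->
          law M x (follower_unif M t @^-1` B) = uniform_prob (@ltr01 R) B
      & mutually_independent (law M x) (fun i : option (nat + nat) =>
          match i with
          | None =>
              sigma_gen (fun t => state M t : Omega -> Borel S) [set: nat]
          | Some (inl t) =>
              preimage_set_system [set: Omega] (leader_unif M t) measurable
          | Some (inr t) =>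
              preimage_set_system [set: Omega] (follower_unif M t) measurable
          end)].

End Assumptions.

(* Stopping times take values in [option nat], [None] standing for +oo. *)
Section ExtendedTimes.

Definition first_time (E : nat -> bool) : option nat :=
  match pselect (exists t, E t) with
  | left ex => Some (ex_minn ex)
  | right _ => None
  end.

(* T <= t *)
Definition time_le (T : option nat) (t : nat) : bool :=
  if T is Some s then (s <= t)%N else false.

(* t <= T *)
Definition time_ge (T : option nat) (t : nat) : bool :=
  if T is Some s then (t <= s)%N else true.

Definition time_min (T T' : option nat) : option nat :=
  match T, T' with
  | Some s, Some t => Some (minn s t)
  | Some s, None => Some s
  | None, _ => T'
  end.

End ExtendedTimes.

Section Game.
Context {R : realType} {S : ptopologicalType} {d : measure_display}
        {Omega : measurableType d}.

Definition R0 : set (Borel S -> R) :=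
  [set p : Borel S -> R | measurable_fun [set: Borel S] p /\ forall x, 0 <= p x <= 1].

(* ln 0 = 0 in the library, whence the convention 0 log 0 = 0. *)
Definition entropy (q : R) : R := - q * ln q - (1 - q) * ln (1 - q).

Context (M : model R S Omega).

(* A strategy of the follower is a pair rq = (r, q). *)
Implicit Types (p : Borel S -> R) (rq : (Borel S -> R) * (Borel S -> R)).
Implicit Types (x : Borel S) (w : Omega) (A : payoffs R S).

Definition leader_time p w : option nat :=
  first_time (fun t => leader_unif M t w <= p (state M t w)).

Definition follower_time p rq w : option nat :=
  first_time (fun t => follower_unif M t w <=
    rq.1 (state M t w) * (time_le (leader_time p w) t)%:R
    + rq.2 (state M t w) * (~~ time_le (leader_time p w) t)%:R).

Definition end_time p rq w : option nat :=
  time_min (leader_time p w) (follower_time p rq w).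

(* Payoff of a player stopping at [own] against an opponent stopping at [opp]:
   F_1(tau, rho) is [payoff A1 w tau rho] and F_2(tau, rho) is
   [payoff A2 w rho tau]. *)
Definition payoff A w (own opp : option nat) : R :=
  match own, opp with
  | Some s, Some t =>
      if (s < t)%N then pay_f A (state M s w)
      else if (t < s)%N then pay_g A (state M t w)
      else pay_h A (state M s w)
  | Some s, None => pay_f A (state M s w)
  | None, Some t => pay_g A (state M t w)
  | None, None => 0
  end.

Definition discounted_payoff A w (own opp : option nat) : R :=
  if time_min own opp is Some n then discount A ^+ n * payoff A w own opp
  else 0.

Definition J1 A1 x p rq : R :=
  \int[law M x]_w
     discounted_payoff A1 w (leader_time p w) (follower_time p rq w).

Definition J2 A2 x p rq : R :=
  \int[law M x]_w
     discounted_payoff A2 w (follower_time p rq w) (leader_time p w).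

(* Taken in \bar R, since the sum is an infinite series of nonnegative terms
   when nobody stops. *)
Definition entropy_bonus A2 x p rq : \bar R :=
  (\int[law M x]_w
     \sum_(0 <= t <oo | time_ge (end_time p rq w) t)
       (discount A2 ^+ t *
        entropy (rq.2 (state M t w) * (~~ time_le (leader_time p w) t)%:R
                 + rq.1 (state M t w) * (leader_time p w == Some t)%:R))%:E)%E.

Definition J2_reg A2 (lam : R) x p rq : R :=
  J2 A2 x p rq + lam * fine (entropy_bonus A2 x p rq).

(* J_1(x, p' (+)_1 p, (r, q)) *)
Definition J1_deviation A1 x p' p rq : R :=
  p' x * (rq.1 x * pay_h A1 x + (1 - rq.1 x) * pay_f A1 x)
  + (1 - p' x) *
    (rq.2 x * pay_g A1 x
     + (1 - rq.2 x) * (discount A1 *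
         \int[law M x]_w J1 A1 (state M 1%N w) p rq)).

(* The sets whose real supremum is taken below are nonempty and bounded when
   [payoffs_ok] holds, so [sup] is the genuine supremum. *)
Definition W_S A2 (lam : R) x : R :=
  sup [set r * pay_h A2 x + (1 - r) * pay_g A2 x + lam * entropy r
      | r in `[0, 1]%classic].

Definition W_C A2 (lam : R) x p : R :=
  sup [set rq.2 x * pay_f A2 x
           + (1 - rq.2 x) * (discount A2 *
               \int[law M x]_w J2_reg A2 lam (state M 1%N w) p rq)
           + lam * entropy (rq.2 x)
      | rq in R0 `*` R0].

Definition r_star A2 (lam : R) x : R :=
  1 / (1 + expR ((pay_g A2 x - pay_h A2 x) / lam)).

Definition q_star A2 (lam : R) p x : R :=
  1 / (1 + expR ((discount A2 *
         \int[law M x]_w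
            (p (state M 1%N w) * W_S A2 lam (state M 1%N w)
             + (1 - p (state M 1%N w)) * W_C A2 lam (state M 1%N w) p)
         - pay_f A2 x) / lam)).

Definition best_response A2 (lam : R) p :
    (Borel S -> R) * (Borel S -> R) :=
  (r_star A2 lam, q_star A2 lam p).

Definition regular_equilibrium A1 A2 (lam : R) p : Prop :=
  R0 p /\
  forall x,
    J2_reg A2 lam x p (best_response A2 lam p) =
      sup [set J2_reg A2 lam x p rq | rq in R0 `*` R0] /\
    J1 A1 x p (best_response A2 lam p) =
      sup [set J1_deviation A1 x p' p (best_response A2 lam p) | p' in R0].

Definition eps_equilibrium A1 A2 (eps : R) p rq : Prop :=
  forall x,
    (forall rq', (R0 `*` R0) rq' -> J2 A2 x p rq >= J2 A2 x p rq' - eps) /\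
    (forall p', R0 p' -> J1 A1 x p rq >= J1_deviation A1 x p' p rq - eps).

End Game.

(* Main.v *)
Require Import Defs.
From HB Require Import structures.
From mathcomp Require Import all_boot all_order all_algebra finmap.
From mathcomp Require Import all_classical all_reals all_analysis.
From mathcomp Require Import ring lra.

Import Order.TTheory GRing.Theory Num.Theory.
Import numFieldNormedType.Exports.

Local Open Scope classical_set_scope.
Local Open Scope ring_scope.

(** The entropy bonus of any strategy lies between [0] and
    [ln 2 / (1 - delta_2)], so [lam] times it is at most [eps] when
    [lam < lam0].  Hence for the follower the regularized and the unregularized
    payoffs differ by at most [eps], in the favourable direction for the
    deviation.  The leader's payoff carries no entropy term, and his equilibrium
    condition is already exact. *)

Section Integral.
Context {d : measure_display} {T : measurableType d} {R : realType}.
Variable P : {measure set T -> \bar R}.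
Hypothesis P1 : P [set: T] = 1%E.

(* The library's monotonicity of the integral asks both functions to be
   measurable; comparing the suprema over simple functions avoids this. *)
Lemma ge0_integral_le_cst (f : T -> \bar R) (C : R) :
  (forall w, 0 <= f w)%E -> (forall w, f w <= C%:E)%E ->
  (\int[P]_w f w <= C%:E)%E.
Proof.
move=> f0 fC.
have -> : C%:E = (\int[P]_w (cst C%:E) w)%E by rewrite integral_cst// P1 mule1.
rewrite !ge0_integralTE//; last by move=> w; exact: le_trans (f0 w) (fC w).
apply: ge_ereal_sup => _ [h hf <-]; apply: ereal_sup_ubound; exists h => //.
by move=> w; exact: le_trans (hf w) (fC w).
Qed.

(** The integrals of the positive and negative parts both lie in [[0, C]]. Neither is infinite, so
    [fine] loses nothing and their difference is at most [C]. *)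
Lemma Rintegral_le_cst (f : T -> R) (C : R) :
  (forall w, `|f w| <= C) -> \int[P]_w f w <= C.
Proof.
move=> fC; rewrite /Rintegral integralE.
set u := (X in (X - _)%E); set v := (X in (_ - X)%E).
have C0 : 0 <= C by exact: le_trans (normr_ge0 _) (fC point).
have v0 : (0 <= v)%E by exact: integral_ge0.
have uC : (u <= C%:E)%E.
  apply: ge0_integral_le_cst => w //.
  rewrite funeposE -EFin_max lee_fin ge_max C0 andbT.
  exact: le_trans (ler_norm _) (fC w).
have vC : (v <= C%:E)%E.
  apply: ge0_integral_le_cst => w //.
  rewrite funenegE -EFinN -EFin_max lee_fin ge_max C0 andbT.
  by rewrite (le_trans (ler_norm _))// normrN.
have u0 : (0 <= u)%E by exact: integral_ge0.
move: u v u0 uC v0 vC => [u| |] [v| |]//=; rewrite !lee_fin; lra.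
Qed.

End Integral.

Section Entropy.
Context {R : realType}.
Implicit Types q delta : R.

Lemma entropy_ge0 q : 0 <= q <= 1 -> 0 <= entropy q.
Proof.
move=> /andP[q0 q1]; rewrite /entropy mulNr -opprD oppr_ge0.
have l1 : ln q <= 0 by exact: ln_le0.
have l2 : ln (1 - q) <= 0 by apply: ln_le0; lra.
nra.
Qed.

(** The right side is the tangent at [1/2] of the concave function on the left. The bound is
    [ln y <= y - 1] at [y = 1 / (2 * q)], multiplied by [q]. Adding it for [q] and [1 - q] leaves
    exactly [ln 2]. *)
Lemma opp_mul_ln_le q : 0 <= q -> - q * ln q <= q * ln 2 + 2^-1 - q.
Proof.
rewrite le_eqVlt => /predU1P[<-|q0]; first by rewrite oppr0 !mul0r; lra.
have i0 : 0 < (2 * q)^-1 by rewrite invr_gt0 mulr_gt0.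
have : ln (2 * q)^-1 <= (2 * q)^-1 - 1.
  by rewrite -[X in ln X](subrKC 1) le_ln1Dx//; lra.
rewrite lnV ?posrE ?mulr_gt0// lnM ?posrE// => /(ler_wpM2l (ltW q0)).
have -> : q * ((2 * q)^-1 - 1) = 2^-1 - q by field; lra.
lra.
Qed.

Lemma entropy_le_ln2 q : 0 <= q <= 1 -> entropy q <= ln 2.
Proof.
move=> /andP[q0 q1]; rewrite /entropy.
have h1 := opp_mul_ln_le _ q0.
have /opp_mul_ln_le h2 : 0 <= 1 - q by lra.
lra.
Qed.

(** Each partial sum is at most a geometric one: the filter [P] only discards nonnegative terms. *)
Lemma discounted_sum_le (L delta : R) (e : nat -> R) (P : pred nat) :
  0 < delta < 1 -> (forall t, 0 <= e t <= L) ->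
  (\sum_(0 <= t <oo | P t) (delta ^+ t * e t)%:E <= (L / (1 - delta))%:E)%E.
Proof.
move=> /andP[d0 d1] eL.
have dn n : 0 <= delta ^+ n by rewrite exprn_ge0// ltW.
have L0 : 0 <= L by have /andP[] := eL 0%N; exact: le_trans.
apply: lime_le.
  apply: is_cvg_nneseries => n _ _; rewrite lee_fin mulr_ge0//.
  by have /andP[] := eL n.
apply: nearW => n; rewrite sumEFin lee_fin big_mkcond/=.
apply: (@le_trans _ _ (\sum_(0 <= t < n) delta ^+ t * L)).
  apply: ler_sum => t _; have /andP[e0 e1] := eL t.
  by case: ifP => _; [exact: ler_wpM2l|exact: mulr_ge0].
rewrite -mulr_suml mulrC big_mkord ler_wpM2l// -[leRHS]mul1r ler_pdivlMr; last by lra.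
have := subrX1 delta n; have := dn n; lra.
Qed.

(** Both components of [best_response] have this form, so their entropy bonus can be bounded. *)
Lemma logistic_itv (y : R) : 0 <= 1 / (1 + expR y) <= 1.
Proof.
have e0 := expR_gt0 y; have e1 : 0 < 1 + expR y by lra.
by rewrite divr_ge0 ?(ltW e1)//= ler_pdivrMr// mul1r lerDl ltW.
Qed.

End Entropy.

Section Game.
Context {R : realType} {S : ptopologicalType} {d : measure_display}
        {Omega : measurableType d}.
Variables (M : model R S Omega) (A : payoffs R S).
Hypothesis HA : payoffs_ok A.
Implicit Types (p : Borel S -> R) (rq : (Borel S -> R) * (Borel S -> R)).

Lemma bounded_borelP (f : Borel S -> R) :
  bounded_borel f -> exists C, forall x, `|f x| <= C.
Proof.
move=> [_ /pinfty_ex_gt0[C _ fC]]; exists C => x; exact: fC.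
Qed.

Lemma discounted_payoff_bounded :
  exists C, forall w own opp, `|discounted_payoff M A w own opp| <= C.
Proof.
have [/bounded_borelP[F HF] /bounded_borelP[G HG] /bounded_borelP[K HK]] := HA.
move=> /andP[d0 d1].
have F0 := le_trans (normr_ge0 _) (HF point).
have G0 := le_trans (normr_ge0 _) (HG point).
have K0 := le_trans (normr_ge0 _) (HK point).
(* The sum of three nonnegative bounds serves every outcome, including the zero payoff when nobody
   stops. *)
exists (F + G + K) => w own opp.
have payC : `|payoff M A w own opp| <= F + G + K.
  rewrite /payoff; case: own opp => [s|] [t|]; last by rewrite normr0; lra.
  - case: ifP => _; first by have := HF (state M s w); lra.
    by case: ifP => _; [have := HG (state M t w)|have := HK (state M s w)]; lra.
  - by have := HF (state M s w); lra.
  - by have := HG (state M t w); lra.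
rewrite /discounted_payoff; case: time_min => [n|]; last by rewrite normr0; lra.
rewrite normrM ger0_norm ?exprn_ge0 ?(ltW d0)//.
by rewrite (le_trans _ payC)// ler_piMl// exprn_ile1 ?(ltW d0) ?(ltW d1).
Qed.

Lemma J2_bounded : exists C, forall x p rq, J2 M A x p rq <= C.
Proof.
have [C HC] := discounted_payoff_bounded; exists C => x p rq.
by apply: Rintegral_le_cst => //; exact: prob_kernel.
Qed.

Lemma entropy_bonus_bounds x p rq :
  (forall y, 0 <= rq.1 y <= 1) -> (forall y, 0 <= rq.2 y <= 1) ->
  0 <= fine (entropy_bonus M A x p rq) <= ln 2 / (1 - discount A).
Proof.
move=> r01 q01; have [_ _ _ HD] := HA; have /andP[d0 d1] := HD.
set e := fun w t => rq.2 (state M t w) * (~~ time_le (leader_time M p w) t)%:R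
                    + rq.1 (state M t w) * (leader_time M p w == Some t)%:R.
(* The two indicators never hold together: [e] is [rq.2] before the leader stops, [rq.1] at that
   time and [0] afterwards. *)
have e01 w t : 0 <= e w t <= 1.
  rewrite /e; have := r01 (state M t w); have := q01 (state M t w).
  case: eqP => [->|_] /=; first by rewrite leqnn mulr0 add0r mulr1.
  by rewrite mulr0 addr0; case: (~~ _); rewrite ?mulr1 ?mulr0// lexx ler01.
have ent w t : 0 <= entropy (e w t) <= ln 2.
  by rewrite entropy_ge0 ?entropy_le_ln2.
have b0 w : (0 <= \sum_(0 <= t <oo | time_ge (end_time M p rq w) t)
    (discount A ^+ t * entropy (e w t))%:E)%E.
  apply: nneseries_ge0 => t _ _.
  by rewrite lee_fin mulr_ge0 ?exprn_ge0 ?(ltW d0)//; have /andP[] := ent w t.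
have B0 : (0 <= entropy_bonus M A x p rq)%E by exact: integral_ge0.
have B1 : (entropy_bonus M A x p rq <= (ln 2 / (1 - discount A))%:E)%E.
  apply: ge0_integral_le_cst => //; first exact: prob_kernel.
  by move=> w; exact: (discounted_sum_le _ _ (fun t => entropy (e w t))).
by case: (entropy_bonus _ _ _ _ _) B0 B1 => //= b; rewrite !lee_fin => -> ->.
Qed.

(** Boundedness makes the [sup] in the equilibrium condition a true upper bound, hence comparable
    with each single deviation. *)
Lemma J2_reg_has_ubound (lam : R) x p :
  0 < lam -> has_ubound [set J2_reg M A lam x p rq | rq in R0 `*` R0].
Proof.
move=> lam0; have [C HC] := J2_bounded.
exists (C + lam * (ln 2 / (1 - discount A))) => _ [rq [[_ r01] [_ q01]] <-].
have /andP[_ b1] := entropy_bonus_bounds x p _ r01 q01.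
by rewrite /J2_reg lerD// ler_wpM2l// ltW.
Qed.

(** A deviation enters only through the number [p' x], which weights two fixed values [a] and [b]
    convexly. *)
Lemma J1_deviation_has_ubound x p rq :
  has_ubound [set J1_deviation M A x p' p rq | p' in R0].
Proof.
rewrite /J1_deviation; set a := _ + _; set b := _ + _.
exists (`|a| + `|b|) => _ [p' [_ p01] <-].
have /andP[p0 p1] := p01 x.
have := ler_norm a; have := ler_norm b.
have := normr_ge0 a; have := normr_ge0 b.
nra.
Qed.

End Game.

Theorem proposition3p28 (R : realType) (S : ptopologicalType)
    (d : measure_display) (Omega : measurableType d)
    (M : model R S Omega)
    (mu : probability (Borel S) R) (pi : Borel S -> Borel S -> R)
    (A1 A2 : payoffs R S) (eps : R) :
  polish_space R S ->
  transition_density mu pi ->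
  markov_chain M mu pi ->
  independent_uniforms M ->
  payoffs_ok A1 ->
  payoffs_ok A2 ->
  0 < eps ->
  let lam0 := (1 - discount A2) * eps / ln 2 in
  0 < lam0 /\
  forall (lam : R) (p : Borel S -> R),
    0 < lam < lam0 ->
    regular_equilibrium M A1 A2 lam p ->
    eps_equilibrium M A1 A2 eps p (best_response M A2 lam p).
Proof.
move=> _ _ _ _ _ A2ok eps0 lam0.
have [_ _ _ /andP[d0 d1]] := A2ok.
have ln20 : 0 < ln (2 : R) by rewrite ln_gt0// ltr1n.
split; first by rewrite divr_gt0// mulr_gt0// subr_gt0.
move=> lam p /andP[lam_gt0 lamlt] [_ eqp] x; have [eq2 eq1] := eqp x.
split=> [rq' R0rq'|p' R0p'].
(* This is where the value of [lam0] comes from: equality would hold at [lam = lam0]. *)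
- have bonus_eps : lam * (ln 2 / (1 - discount A2)) <= eps.
    rewrite mulrA ler_pdivrMr; last by lra.
    by move: lamlt; rewrite /lam0 ltr_pdivlMr// [leRHS]mulrC => /ltW.
  have le_reg : J2_reg M A2 lam x p rq' <=
      J2_reg M A2 lam x p (best_response M A2 lam p).
    rewrite eq2; apply: ub_le_sup; last by exists rq'.
    exact: J2_reg_has_ubound.
  have [[_ r01] [_ q01]] := R0rq'.
  have /andP[b0 _] := entropy_bonus_bounds M A2 A2ok x p _ r01 q01.
  have /andP[_ b1] := entropy_bonus_bounds M A2 A2ok x p
    (best_response M A2 lam p) (fun=> logistic_itv _) (fun=> logistic_itv _).
  (* The deviation's bonus is dropped by [b0]; that of the best response costs at most [eps] by [b1]
     and [bonus_eps]. *)
  move: le_reg; rewrite /J2_reg.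
  have := mulr_ge0 (ltW lam_gt0) b0; have := ler_wpM2l (ltW lam_gt0) b1.
  lra.
- suff : J1_deviation M A1 x p' p (best_response M A2 lam p) <=
      J1 M A1 x p (best_response M A2 lam p) by lra.
  by rewrite eq1; apply: ub_le_sup; [exact: J1_deviation_has_ubound|exists p'].
Qed.
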